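(* Let $G$ be a finite abelian group and $S\subseteq G$ a symmetric subset with $0\notin S$. For $\chi\in\widehat G$, the eigenvalues of $X^+(G,S)$ are $\pm e_\chi\in\mathbb{R}$, with multiplicities given by $$m^{+}(e_\chi) = \#[\chi]_{\mathbb{R}} + \tfrac 12 \# [\chi]_{\mathbb{R}^c} + \tfrac 12 \#\widetilde{[\chi]}_{\mathbb{R}^c},\qquad m^{+}(-e_\chi) = \#\widetilde{[\chi]}_{\mathbb{R}} + \tfrac 12 \#[\chi]_{\mathbb{R}^c} + \tfrac 12 \#\widetilde{[\chi]}_{\mathbb{R}^c}.$$ Moreover, $m^{+}(0)=m(0)$ and, for $e_\chi\ne 0$, $$m(e_\chi)+m(-e_\chi)=m^{+}(e_\chi)+m^{+}(-e_\chi).$$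
   Context: For a finite abelian group $G$ (written additively) and a symmetric subset $S$ ($-S=S$) with $0\notin S$: $X(G,S)$ is the graph with vertex set $G$ in which $v,w$ are adjacent iff $w-v\in S$; $X^+(G,S)$ is the graph with vertex set $G$ in which $v,w$ are adjacent iff $v+w\in S$ (loops allowed, at $x$ with $x+x\in S$). Eigenvalues are those of the adjacency matrix (a loop gives a diagonal entry $1$). $m(\lambda)$ (resp. $m^+(\lambda)$) denotes the multiplicity of $\lambda$ as an eigenvalue of $X(G,S)$ (resp. $X^+(G,S)$), with the convention that it is $0$ if $\lambda$ is not an eigenvalue. $\widehat G$ is the set of group homomorphisms $\chi:G\to\mathbb{S}^1\subset\mathbb{C}^*$, and $e_\chi=\sum_{s\in S}\chi(s)$ (this is real since $S$ is symmetric). Put $[\chi]=\{\chi'\in\widehat G: e_{\chi'}=e_\chi\}$ and $\widetilde{[\chi]}=\{\chi'\in\widehat G: e_{\chi'}=-e_\chi\}$. Further, $[\chi]_{\mathbb{R}}=\{\rho\in[\chi]:\rho^{-1}=\rho\}$, $[\chi]_{\mathbb{R}^c}=\{\rho\in[\chi]:\rho^{-1}\neq\rho\}$, $\widetilde{[\chi]}_{\mathbb{R}}=\{\rho\in\widetilde{[\chi]}:\rho^{-1}=\rho\}$, $\widetilde{[\chi]}_{\mathbb{R}^c}=\{\rho\in\widetilde{[\chi]}:\rho^{-1}\neq\rho\}$. *)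

(* Defs.v *)
From HB Require Import structures.
From mathcomp Require Import all_boot all_order all_algebra.
From mathcomp Require Import fingroup cyclic.

Set Implicit Arguments.
Unset Strict Implicit.
Unset Printing Implicit Defensive.

Import Order.TTheory GRing.Theory Num.Theory.
Local Open Scope ring_scope.

Section Graphs.
Variables (G : finZmodType) (S : {set G}).

Definition cayley_graph : rel G := [rel v w | w - v \in S].

Definition cayley_sum_graph : rel G := [rel v w | v + w \in S].

End Graphs.

Definition adjacency_mx (F : nzRingType) (T : finType) (e : rel T) : 'M[F]_#|T| :=
  \matrix_(i, j) (e (enum_val i) (enum_val j))%:R.

(* Algebraic multiplicity; [mup] is 0 at a non-root, hence so is
   [eigenmult A a] when a is not an eigenvalue of A. *)
Definition eigenmult (F : fieldType) n (A : 'M[F]_n) (a : F) : nat :=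
  mup a (char_poly A).

Lemma eigenmult_gt0 (F : fieldType) n (A : 'M[F]_n) (a : F) :
  (0 < eigenmult A a)%N = eigenvalue A a.
Proof.
by rewrite eigenvalue_root_char /eigenmult -XsubC_dvd ?monic_neq0 ?char_poly_monic // dvdp_XsubCl.
Qed.

Section Dual.
Variables (C : numClosedFieldType) (G : finZmodType).

Definition is_unitary_character (f : {ffun G -> C}) : bool :=
  [forall x, forall y, f (x + y) == f x * f y] && [forall x, `|f x| == 1].

Record dual_group := DualGroup {
  dual_val :> {ffun G -> C};
  dual_valP : is_unitary_character dual_val }.

HB.instance Definition _ := [isSub for dual_val].
HB.instance Definition _ := [Choice of dual_group by <:].

Implicit Type chi : dual_group.

Lemma dualD chi x y : chi (x + y) = chi x * chi y.
Proof. by have /andP[/forallP/(_ x)/forallP/(_ y)/eqP] := dual_valP chi. Qed.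

Lemma dual_norm chi x : `|chi x| = 1.
Proof. by have /andP[_ /forallP/(_ x)/eqP] := dual_valP chi. Qed.

Lemma dual_neq0 chi x : chi x != 0.
Proof. by rewrite -normr_gt0 dual_norm. Qed.

Lemma dual0 chi : chi 0 = 1.
Proof. by apply: (mulfI (dual_neq0 chi 0)); rewrite -dualD addr0 mulr1. Qed.

Lemma dualMn chi x n : chi (x *+ n) = chi x ^+ n.
Proof. by elim: n => [|n IH]; rewrite ?dual0 // mulrS dualD IH exprS. Qed.

Lemma dual_unity chi x : chi x ^+ #|G| = 1.
Proof.
rewrite -dualMn -FinRing.zmodXgE -cardsT.
by rewrite (@expg_cardG _ [set: G]%G) ?inE ?dual0.
Qed.

(* The values of a character are #|G|-th roots of unity, so the dual is finite. *)
Let roots : seq C := sval (closed_field_poly_normal ('X^#|G| - 1 : {poly C})).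

Lemma mem_roots chi x : chi x \in roots.
Proof.
rewrite /roots; case: closed_field_poly_normal => r /= Dp.
have n_gt0 : (0 < #|G|)%N by apply/card_gt0P; exists 0.
have : root ('X^#|G| - 1 : {poly C}) (chi x).
  by rewrite /root !hornerE dual_unity subrr.
by rewrite Dp rootZ ?root_prod_XsubC // lead_coef_eq0 monic_neq0 // monicXnsubC.
Qed.

Let encode chi : {ffun G -> 'I_(size roots).+1} :=
  [ffun x => inord (index (chi x) roots)].

Let decode (k : {ffun G -> 'I_(size roots).+1}) : option dual_group :=
  insub [ffun x => nth 0 roots (k x)].

Lemma encodeK : pcancel encode decode.
Proof.
move=> chi; rewrite /decode.
suff -> : [ffun x => nth 0 roots (encode chi x)] = dual_val chi by rewrite valK.
apply/ffunP=> x; rewrite !ffunE inordK ?nth_index ?mem_roots //.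
by rewrite ltnS index_size.
Qed.

HB.instance Definition _ : isCountable dual_group := PCanIsCountable encodeK.
HB.instance Definition _ : isFinite dual_group := PCanIsFinite encodeK.

Fact dual_inv_subproof chi : is_unitary_character [ffun x => (chi x)^-1].
Proof.
apply/andP; split; apply/forallP=> x; last by rewrite ffunE normfV dual_norm invr1.
by apply/forallP=> y; rewrite !ffunE dualD invfM.
Qed.

Definition dual_inv chi : dual_group := DualGroup (dual_inv_subproof chi).

Definition char_sum (S : {set G}) chi : C := \sum_(s in S) chi s.

Definition sum_class (S : {set G}) chi : {set dual_group} :=
  [set rho | char_sum S rho == char_sum S chi].

Definition opp_sum_class (S : {set G}) chi : {set dual_group} :=
  [set rho | char_sum S rho == - char_sum S chi].

Definition real_part (A : {set dual_group}) : {set dual_group} :=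
  [set rho in A | dual_inv rho == rho].

Definition nonreal_part (A : {set dual_group}) : {set dual_group} :=
  [set rho in A | dual_inv rho != rho].

End Dual.

(* Main.v *)
Require Import Defs.
From mathcomp Require Import all_boot all_order all_algebra.
From mathcomp Require Import fingroup cyclic.
From mathcomp Require Import reals.
From mathcomp.real_closed Require Import complex.
From mathcomp Require Import ring lra zify.
Set Implicit Arguments.
Unset Strict Implicit.
Unset Printing Implicit Defensive.
Import Order.TTheory GRing.Theory Num.Theory.
Local Open Scope ring_scope.
Local Open Scope complex_scope.

(** Let A and A+ be the adjacency matrices of the Cayley graph and of the
Cayley sum graph, and write e_chi for the sum of the character chi over S.
Since S is symmetric, e_chi = e_(chi^-1), so that e_chi is real.  Summing
chi over the neighbours of y gives
   e_chi * chi(y)        in the Cayley graph,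
   e_chi * chi^-1(y)     in the Cayley sum graph.
So the characters are eigenfunctions of A, whereas A+ swaps the lines of chi
and of chi^-1.  For a real character chi is an eigenfunction of A+ for e_chi;
for a pair {chi, chi^-1} of nonreal characters, chi + chi^-1 and chi - chi^-1
are eigenfunctions for e_chi and - e_chi.  Hence each nonreal pair with sum a
contributes one to the multiplicities of both a and - a, which is

  2 m+(a) = 2 #real(a) + #nonreal(a) + #nonreal(-a)

([double_eigenmult_cayley_sum]); here real(a) and nonreal(a) are the real and
the nonreal characters with sum a.  As m(a) = #real(a) + #nonreal(a)
([eigenmult_cayley]), the two comparisons of m with m+ are arithmetic.

To read multiplicities off eigenfunctions, a full basis of them is needed
([eigenmult_adjacency_mx]).  Their independence follows from the
orthogonality of characters; that there are enough of them is [card_dual].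
For the latter, the translation matrices of G commute and are normal, hence
are diagonal in a common basis, and a common eigenvector of all translations
is a multiple of a character. *)

(** * Adjacency matrices with a basis of eigenfunctions *)

(** The two sizes are only propositionally equal, as happens for a basis
indexed by another type than the coordinates. *)
Lemma char_poly_similar_row_free (F : fieldType) m n
    (V : 'M[F]_(m, n)) (A : 'M_n) (D : 'M_m) :
  m = n -> row_free V -> V *m A = D *m V -> char_poly A = char_poly D.
Proof.
move=> mn; subst m => Vfree VA.
have Vpoly : map_mx polyC V *m char_poly_mx A = char_poly_mx D *m map_mx polyC V.
  rewrite /char_poly_mx mulmxBr mulmxBl -!map_mxM VA.
  by rewrite mul_mx_scalar mul_scalar_mx.
have detV : \det (map_mx polyC V) != 0.
  by rewrite det_map_mx polyC_eq0 -unitfE -unitmxE -row_free_unit.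
apply: (mulfI detV); rewrite /char_poly -det_mulmx Vpoly det_mulmx.
by rewrite mulrC.
Qed.

Section EigenBasis.
Variables (F : fieldType) (T I : finType).

Definition family_mx (v : I -> T -> F) : 'M_(#|I|, #|T|) :=
  \matrix_(i, x) v (enum_val i) (enum_val x).

(** The rescaled dual family is a right inverse of the matrix of the family. *)
Lemma biorthogonal_row_free (v w : I -> T -> F) (n : I -> F) :
    (forall i j, \sum_x v i x * w j x = (i == j)%:R * n i) ->
    (forall i, n i != 0) ->
  row_free (family_mx v).
Proof.
move=> vw n_neq0.
pose W := \matrix_(x < #|T|, j < #|I|)
  (w (enum_val j) (enum_val x) / n (enum_val j)).
apply/row_freeP; exists W; apply/matrixP => i j; rewrite !mxE.
have := vw (enum_val i) (enum_val j).
rewrite (reindex _ (onW_bij _ (enum_val_bij T))) /=.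
under [X in _ -> X = _]eq_bigr do rewrite !mxE mulrA.
rewrite -mulr_suml => ->.
rewrite (inj_eq enum_val_inj); case: eqVneq => [->|_]; last by rewrite !mul0r.
by rewrite mul1r divff.
Qed.

Lemma char_poly_adjacency_mx (e : rel T) (v w : I -> T -> F) (n c : I -> F) :
    #|I| = #|T| ->
    (forall i j, \sum_x v i x * w j x = (i == j)%:R * n i) ->
    (forall i, n i != 0) ->
    (forall i y, \sum_(x | e x y) v i x = c i * v i y) ->
  char_poly (adjacency_mx F e) = \prod_i ('X - (c i)%:P).
Proof.
move=> IT vw n_neq0 eig.
pose D := diag_mx (\row_(i < #|I|) c (enum_val i)).
rewrite (char_poly_similar_row_free (D := D) IT (biorthogonal_row_free vw n_neq0)).
  rewrite char_poly_trig ?diag_mx_is_trig //.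
  rewrite [RHS](reindex _ (onW_bij _ (enum_val_bij I))) /=.
  by apply: eq_bigr => i _; rewrite !mxE eqxx.
apply/matrixP => i y; rewrite mul_diag_mx !mxE -eig [RHS]big_mkcond.
rewrite [RHS](reindex _ (onW_bij _ (enum_val_bij T))) /=.
by apply: eq_bigr => x _; rewrite !mxE; case: (e _ _); rewrite ?mulr1 ?mulr0.
Qed.

(** A biorthogonal system of the right size is a basis, so the [c i] are all
the eigenvalues, with their algebraic multiplicities.  The equation reads
neighbours along columns, which makes the functions left eigenvectors. *)
Lemma eigenmult_adjacency_mx (e : rel T) (v w : I -> T -> F) (n c : I -> F) a :
    #|I| = #|T| ->
    (forall i j, \sum_x v i x * w j x = (i == j)%:R * n i) ->
    (forall i, n i != 0) ->
    (forall i y, \sum_(x | e x y) v i x = c i * v i y) ->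
  eigenmult (adjacency_mx F e) a = #|[set i | c i == a]|.
Proof.
move=> IT vw n_neq0 eig; rewrite /eigenmult.
rewrite (char_poly_adjacency_mx IT vw n_neq0 eig).
rewrite -(big_map c xpredT (fun z => 'X - z%:P)) mu_prod_XsubC count_map.
rewrite -sum1_card -sum1_count.
by apply: eq_bigl => i; rewrite inE.
Qed.

End EigenBasis.

(** * A finite abelian group has as many characters as elements *)

Section Characters.
Variables (C : numClosedFieldType) (G : finZmodType).
Implicit Types chi rho : dual_group C G.

Lemma dual_invE chi x : dual_inv chi x = (chi x)^-1.
Proof. by rewrite ffunE. Qed.

Lemma dual_ext chi rho : (forall x, chi x = rho x) -> chi = rho.
Proof. by move=> E; apply: val_inj; apply/ffunP. Qed.

Lemma dual_invK : involutive (@dual_inv C G).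
Proof. by move=> chi; apply: dual_ext => x; rewrite !dual_invE invrK. Qed.

Lemma dualN chi x : chi (- x) = (chi x)^-1.
Proof.
by apply: (mulfI (dual_neq0 chi x)); rewrite -dualD subrr dual0 divff ?dual_neq0.
Qed.

Lemma card_group_neq0 : #|G|%:R != 0 :> C.
Proof. by rewrite pnatr_eq0 -lt0n; apply/card_gt0P; exists 0. Qed.

(** If chi differs from rho at y, translating the sum by y multiplies it by
chi(y) / rho(y), which is not 1, so the sum vanishes. *)
Lemma dual_orthogonality chi rho :
  \sum_x chi x * (rho x)^-1 = (chi == rho)%:R * #|G|%:R.
Proof.
case: eqVneq => [->|neq_chi_rho].
  under eq_bigr do rewrite divff ?dual_neq0 //.
  by rewrite sumr_const mul1r.
have [y chi_y] : exists y, chi y != rho y.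
  apply/existsP; rewrite -negb_forall; apply: contra neq_chi_rho.
  by move=> /forallP E; apply/eqP/dual_ext => x; apply/eqP.
rewrite mul0r; set s := \sum_x _.
have : (chi y / rho y - 1) * s = 0.
  apply/eqP; rewrite mulrBl mul1r subr_eq0; apply/eqP.
  rewrite /s mulr_sumr [RHS](reindex_inj (addrI y)) /=.
  by apply: eq_bigr => x _; rewrite !dualD invfM mulrACA.
move/eqP; rewrite mulf_eq0 subr_eq0 => /orP[/eqP E|/eqP //].
by rewrite -[chi y](divfK (dual_neq0 rho y)) E mul1r eqxx in chi_y.
Qed.

(** The norm condition is automatic: values are roots of unity of order
dividing #|G|, and 1 is the only nonnegative root of unity. *)
Lemma is_unitary_character_hom (f : {ffun G -> C}) :
    (forall x y, f (x + y) = f x * f y) -> f 0 = 1 ->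
  is_unitary_character f.
Proof.
move=> fD f0; apply/andP; split.
  by apply/forallP => x; apply/forallP => y; rewrite fD.
apply/forallP => x.
have n_gt0 : (0 < #|G|)%N by apply/card_gt0P; exists 0.
have fMn n : f (x *+ n) = f x ^+ n.
  by elim: n => [|n IH]; rewrite ?f0 // mulrS fD IH exprS.
have xn : x *+ #|G| = 0.
  rewrite -FinRing.zmodXgE -cardsT.
  by rewrite (@expg_cardG _ [set: G]%G) ?inE.
have := fMn #|G|; rewrite xn f0 => /(congr1 Num.norm)/esym/eqP.
by rewrite normr1 normrX pexpr_eq1.
Qed.

(** This permutation matrix is arranged so that it acts on row vectors, seen as
functions on G, by the translation y |-> y + g of the argument. *)
Definition shift_mx (g : G) : 'M[C]_#|G| :=
  \matrix_(i, j) (enum_val i == enum_val j + g)%:R.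

Lemma row_shift_mx m (P : 'M[C]_(m, #|G|)) g i y :
  (P *m shift_mx g) i (enum_rank y) = P i (enum_rank (y + g)).
Proof.
rewrite mxE (bigD1 (enum_rank (y + g))) //= big1 => [|j /negbTE neq_j].
  by rewrite mxE !enum_rankK eqxx mulr1 addr0.
by rewrite mxE enum_rankK -(inj_eq enum_rank_inj) enum_valK neq_j mulr0.
Qed.

Lemma shift_mxD g h : shift_mx g *m shift_mx h = shift_mx (g + h).
Proof.
apply/matrixP => i j; rewrite -[j]enum_valK row_shift_mx !mxE !enum_rankK.
by rewrite -addrA (addrC h).
Qed.

(** The adjoint of a translation is the inverse translation. *)
Lemma shift_mx_normal g : shift_mx g \is normalmx.
Proof.
suff E : map_mx Num.conj (shift_mx g)^T = shift_mx (- g).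
  by apply/normalmxP; rewrite E !shift_mxD addrC.
apply/matrixP => i j; rewrite !mxE rmorph_nat.
by rewrite -subr_eq eq_sym.
Qed.

(** Commuting diagonalizable matrices have a common basis of eigenvectors; the
spectral theorem makes each translation diagonalizable. *)
Lemma codiagonalizable_shift_mx :
  exists2 P : 'M[C]_#|G|, P \in unitmx &
    forall g, exists d, P *m shift_mx g = diag_mx d *m P.
Proof.
have [] := (codiagonalizableP [seq shift_mx g | g <- enum G]).1.
  split=> [_ _ /mapP[g _ ->] /mapP[h _ ->]|_ /mapP[g _ ->]].
    by rewrite /comm_mx !shift_mxD addrC.
  have Pu := spectral_unit (shift_mx g).
  exists (spectralmx (shift_mx g)) => //.
  apply/(similar_diagLR Pu); exists (spectral_diag (shift_mx g)).
  by rewrite conjVmx //; apply/orthomx_spectralP/shift_mx_normal.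
move=> P Pu /allP Pdiag; exists P => // g.
have /Pdiag /= : shift_mx g \in [seq shift_mx g | g <- enum G].
  by apply: map_f; rewrite mem_enum.
move=> /(similar_diagLR Pu)[d ->]; exists d.
by rewrite conjVmx // !mulmxA mulmxV // mul1mx.
Qed.

(** Orthogonality makes the rows of the character matrix independent, so there
are at most #|G| characters.  Conversely each vector of a common eigenbasis
of the translations is a multiple of a character, so the row space of the
character matrix is everything. *)
Lemma card_dual : #|{: dual_group C G}| = #|G|.
Proof.
pose K := family_mx (fun chi x => chi x : C).
have Kfree : row_free K.
  by apply: (biorthogonal_row_free dual_orthogonality) => _; apply: card_group_neq0.
apply/eqP; rewrite eqn_leq -{1}(eqP Kfree) rank_leq_col /=.
have [P Pu Pdiag] := codiagonalizable_shift_mx.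
rewrite -{1}(mxrank_unit Pu) (leq_trans (mxrankS _) (rank_leq_row K)) //.
apply/row_subP => i; pose p x := P i (enum_rank x).
have pD x y : p (x + y) * p 0 = p x * p y.
  have [d /matrixP Pd] := Pdiag y.
  have E z : p (z + y) = d 0 i * p z.
    by rewrite /p -row_shift_mx Pd mul_diag_mx mxE.
  by rewrite E -(add0r y) E; ring.
(* By pD, p 0 = 0 forces p = 0; otherwise p / p 0 is multiplicative. *)
have [p0|p0] := eqVneq (p 0) 0.
  rewrite (_ : row i P = 0) ?sub0mx //; apply/rowP => j; rewrite !mxE.
  apply/eqP; rewrite -sqrf_eq0 -[j]enum_valK expr2.
  by rewrite -[X in X * _]/(p _) -[X in _ * X]/(p _) -pD p0 mulr0.
have chiP : is_unitary_character [ffun x => p x / p 0].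
  apply: is_unitary_character_hom => [x y|]; rewrite !ffunE ?divff //.
  by apply: (mulIf (mulf_neq0 p0 p0)); rewrite mulrA divfK // pD; field.
rewrite (_ : row i P = p 0 *: row (enum_rank (DualGroup chiP)) K).
  by rewrite scalemx_sub ?row_sub.
apply/rowP => j; rewrite !mxE enum_rankK /= ffunE mulrCA divff // mulr1.
by rewrite /p enum_valK.
Qed.

End Characters.

(** * The two spectra *)

Section Spectra.
Variables (C : numClosedFieldType) (G : finZmodType) (S : {set G}).
Hypothesis S_sym : [set - s | s in S] = S.
Implicit Types (chi rho : dual_group C G) (B : {set dual_group C G}).

Local Notation dual := (dual_group C G).
Local Notation e := (char_sum S).
Local Notation inv := (@dual_inv C G).

Lemma oppr_mem_sym x : (- x \in S) = (x \in S).
Proof. by rewrite -{1}S_sym (mem_imset _ _ oppr_inj). Qed.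

Lemma char_sum_inv chi : e (inv chi) = e chi.
Proof.
rewrite /char_sum (reindex_inj oppr_inj) /=.
by apply: eq_big => [x|x _]; rewrite ?oppr_mem_sym // dual_invE dualN invrK.
Qed.

Lemma char_sum_real chi : e chi \is Num.real.
Proof.
apply/CrealP; rewrite -[RHS]char_sum_inv rmorph_sum; apply: eq_bigr => x _.
by rewrite dual_invE invC_norm dual_norm expr1n invr1 mul1r.
Qed.

Lemma cayley_sum_dual chi y :
  \sum_(x | cayley_sum_graph S x y) chi x = e chi * (chi y)^-1.
Proof.
rewrite (reindex_inj (addIr (- y))) /= mulr_suml.
by apply: eq_big => [x|x _]; rewrite /cayley_sum_graph /= ?subrK // dualD dualN.
Qed.

Lemma cayley_dual chi y :
  \sum_(x | cayley_graph S x y) chi x = e chi * chi y.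
Proof.
rewrite -{1}char_sum_inv (reindex_inj (can_inj (subKr y))) /= mulr_suml.
apply: eq_big => [x|x _]; rewrite /cayley_graph /= ?subKr //.
by rewrite dualD dualN dual_invE mulrC.
Qed.

Definition level_set (a : C) : {set dual} := [set chi | e chi == a].

Lemma eigenmult_cayley a :
  eigenmult (adjacency_mx C (cayley_graph S)) a = #|level_set a|.
Proof.
apply: (@eigenmult_adjacency_mx _ _ _ _ (fun chi x => chi x) _ (fun=> #|G|%:R)).
- exact: card_dual.
- exact: dual_orthogonality.
- by move=> _; apply: card_group_neq0.
- exact: cayley_dual.
Qed.

(** An arbitrary total order of the dual group singles out one member of each
pair {chi, chi^-1} of nonreal characters. *)
Definition is_second chi := (enum_rank (inv chi) < enum_rank chi)%N.

Definition pair_sign chi : C := (-1) ^+ is_second chi.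

Lemma is_second_real chi : inv chi = chi -> is_second chi = false.
Proof. by move=> E; rewrite /is_second E ltnn. Qed.

Lemma is_second_inv chi : inv chi != chi -> is_second (inv chi) = ~~ is_second chi.
Proof.
rewrite -(inj_eq enum_rank_inj) -(inj_eq val_inj) /is_second dual_invK /=.
by case: ltngtP.
Qed.

Lemma pair_sign_sq chi : pair_sign chi * pair_sign chi = 1.
Proof. by rewrite -expr2 sqrr_sign. Qed.

Lemma pair_sign_real chi : inv chi = chi -> pair_sign chi = 1.
Proof. by rewrite /pair_sign => /is_second_real ->. Qed.

Lemma pair_sign_inv chi : inv chi != chi -> pair_sign (inv chi) = - pair_sign chi.
Proof. by rewrite /pair_sign => /is_second_inv ->; rewrite signrN. Qed.

(** The eigenfunction of A+ attached to chi, with eigenvalue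
[pair_sign chi * e chi].  Up to sign, the two members of a nonreal pair
yield the sum and the difference of the pair; a real chi yields 2 chi. *)
Definition pair_fun chi x : C := chi x + pair_sign chi * (chi x)^-1.

Definition pair_cofun chi x : C := (chi x)^-1 + pair_sign chi * chi x.

Definition pair_norm chi : C := (if inv chi == chi then 4 else 2) * #|G|%:R.

(** Expanding gives four character sums.  The two mixed ones survive if chi is
the inverse of rho; for a nonreal pair they then cancel, the signs being
opposite, while for a real character all four add up to 4 #|G|. *)
Lemma pair_biorthogonal chi rho :
  \sum_x pair_fun chi x * pair_cofun rho x = (chi == rho)%:R * pair_norm chi.
Proof.
have -> : \sum_x pair_fun chi x * pair_cofun rho x =
    \sum_x chi x * (rho x)^-1
    + pair_sign rho * \sum_x chi x * (inv rho x)^-1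
    + pair_sign chi * \sum_x inv chi x * (rho x)^-1
    + pair_sign chi * pair_sign rho * \sum_x inv chi x * (inv rho x)^-1.
  rewrite !mulr_sumr -!big_split /=; apply: eq_bigr => x _.
  by rewrite /pair_fun /pair_cofun !dual_invE invrK; ring.
rewrite !dual_orthogonality (inj_eq (inv_inj (@dual_invK C G))).
rewrite -(can2_eq (@dual_invK C G) (@dual_invK C G)) /pair_norm.
case: (eqVneq chi rho) => [<-|neq_chi_rho].
  rewrite pair_sign_sq; case: eqVneq => [/pair_sign_real ->|_]; rewrite /=; ring.
case: (eqVneq (inv chi) rho) neq_chi_rho => [<- neq_inv|_ _]; last first.
  by rewrite /=; ring.
by rewrite pair_sign_inv 1?eq_sym //=; ring.
Qed.

Lemma pair_norm_neq0 chi : pair_norm chi != 0.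
Proof.
by rewrite mulf_neq0 ?card_group_neq0 //; case: ifP; rewrite pnatr_eq0.
Qed.

Lemma cayley_sum_pair_fun chi y :
  \sum_(x | cayley_sum_graph S x y) pair_fun chi x
  = pair_sign chi * e chi * pair_fun chi y.
Proof.
rewrite big_split -mulr_sumr /= cayley_sum_dual.
rewrite (eq_bigr (inv chi)) => [|x _]; last by rewrite dual_invE.
rewrite cayley_sum_dual char_sum_inv dual_invE invrK /pair_fun mulrDr.
rewrite [pair_sign chi * e chi * (_ * _)]mulrACA pair_sign_sq mul1r mulrA.
exact: addrC.
Qed.

Lemma eigenmult_cayley_sum a :
  eigenmult (adjacency_mx C (cayley_sum_graph S)) a =
  #|[set chi | pair_sign chi * e chi == a]|.
Proof.
apply: eigenmult_adjacency_mx.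
- exact: card_dual.
- exact: pair_biorthogonal.
- exact: pair_norm_neq0.
- exact: cayley_sum_pair_fun.
Qed.

(** Inversion exchanges the first and the second members of the pairs. *)
Lemma card_half B b :
    (forall chi, (inv chi \in B) = (chi \in B)) ->
    (forall chi, chi \in B -> inv chi != chi) ->
  (#|B| = 2 * #|[set chi in B | is_second chi == b]|)%N.
Proof.
move=> invB B_nonreal; set Bb := [set _ in _ | _].
rewrite -(cardsID Bb B) mul2n -addnn; congr (_ + _)%N.
  by rewrite (setIidPr _) //; apply/subsetP => chi; rewrite inE => /andP[].
rewrite -(card_imset Bb (inv_inj (@dual_invK C G))); apply: eq_card => chi.
rewrite -{2}[chi]dual_invK (mem_imset _ _ (inv_inj (@dual_invK C G))) !inE invB.
rewrite andbC; case: (boolP (chi \in B)) => //= chiB.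
by rewrite is_second_inv ?B_nonreal //; case: (is_second _) b {Bb} => [] [].
Qed.

Lemma card_real_nonreal B : (#|real_part B| + #|nonreal_part B| = #|B|)%N.
Proof.
rewrite -(cardsID [set chi | inv chi == chi] B).
by congr (_ + _)%N; apply: eq_card => chi; rewrite !inE // andbC.
Qed.

Lemma card_half_nonreal a b :
  (#|nonreal_part (level_set a)| =
   2 * #|[set chi in nonreal_part (level_set a) | is_second chi == b]|)%N.
Proof.
apply: card_half => chi; rewrite !inE; last by case/andP.
by rewrite char_sum_inv dual_invK (eq_sym chi).
Qed.

(** The eigenfunctions of A+ for a come from the real characters of sum a, the
first members of nonreal pairs of sum a, and the second members of nonreal
pairs of sum - a; the last two kinds are half of the nonreal characters of
sum a and of sum - a. *)
Lemma double_eigenmult_cayley_sum a :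
  (2 * eigenmult (adjacency_mx C (cayley_sum_graph S)) a =
   2 * #|real_part (level_set a)| + #|nonreal_part (level_set a)|
   + #|nonreal_part (level_set (- a))|)%N.
Proof.
rewrite (card_half_nonreal a false) (card_half_nonreal (- a) true) -!mulnDr.
congr (2 * _)%N; rewrite eigenmult_cayley_sum -addnA -[LHS]card_real_nonreal.
congr (_ + _)%N.
  apply: eq_card => chi; rewrite !inE.
  by case: (eqVneq (inv chi) chi) => [/pair_sign_real ->|]; rewrite ?andbF ?mul1r.
rewrite -(cardsID [set chi | ~~ is_second chi] (nonreal_part _)).
congr (_ + _)%N; apply: eq_card => chi; rewrite !inE /pair_sign.
  by case: is_second; rewrite ?andbF //= mul1r.
by case: is_second; rewrite ?andbF //= mulN1r eqr_oppLR andbT.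
Qed.

End Spectra.

Theorem proposition2p5 (R : realType) (G : finZmodType) (S : {set G})
    (S_sym : [set - s | s in S] = S) (S_not0 : 0 \notin S) :
  let A := adjacency_mx R[i] (cayley_graph S) in
  let Aplus := adjacency_mx R[i] (cayley_sum_graph S) in
  let m := eigenmult A in
  let mplus := eigenmult Aplus in
  let e := @char_sum R[i] G S in
  [/\ forall chi : dual_group R[i] G, e chi \is Num.real,
      forall a : R[i], eigenvalue Aplus a ->
        exists chi : dual_group R[i] G, a = e chi \/ a = - e chi,
      forall chi : dual_group R[i] G,
        (mplus (e chi))%:R =
            #|real_part (sum_class S chi)|%:R
            + 1 / 2 * #|nonreal_part (sum_class S chi)|%:R
            + 1 / 2 * #|nonreal_part (opp_sum_class S chi)|%:R :> rat
        /\ (mplus (- e chi))%:R =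
            #|real_part (opp_sum_class S chi)|%:R
            + 1 / 2 * #|nonreal_part (sum_class S chi)|%:R
            + 1 / 2 * #|nonreal_part (opp_sum_class S chi)|%:R :> rat,
      mplus 0 = m 0
    & forall chi : dual_group R[i] G, e chi != 0 ->
        (m (e chi) + m (- e chi) = mplus (e chi) + mplus (- e chi))%N].
Proof.
move=> A Aplus m mplus e.
have m_level a : m a = #|level_set S a| by apply: eigenmult_cayley.
have mplus_level (a : R[i]) : (2 * mplus a = 2 * #|real_part (level_set S a)|
    + #|nonreal_part (level_set S a)| + #|nonreal_part (level_set S (- a))|)%N.
  exact: double_eigenmult_cayley_sum.
split.
- by move=> chi; apply: char_sum_real.
- move=> a; rewrite -eigenmult_gt0 eigenmult_cayley_sum // => /card_gt0P[chi].
  rewrite inE => /eqP <-; exists chi; rewrite /pair_sign.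
  by case: is_second; rewrite ?mulN1r ?mul1r; [right|left].
- have half (p q r s : nat) :
      (2 * p = 2 * q + r + s)%N ->
      p%:R = q%:R + 1 / 2 * r%:R + 1 / 2 * s%:R :> rat.
    move=> /(congr1 (fun n : nat => n%:R : rat)).
    by rewrite (natrD _ _ s) (natrD _ _ r) !(natrM _ 2); lra.
  move=> chi; split; apply: half; first exact: mplus_level.
  by rewrite mplus_level opprK addnAC.
- have := mplus_level 0; rewrite oppr0 m_level -(card_real_nonreal (level_set S 0)).
  move: (mplus 0) #|real_part _| #|nonreal_part _| => p q r; lia.
- move=> chi _; have := mplus_level (- e chi); have := mplus_level (e chi).
  rewrite opprK !m_level -(card_real_nonreal (level_set S (e chi))).
  rewrite -(card_real_nonreal (level_set S (- e chi))).
  move: (mplus (e chi)) (mplus (- e chi)) => p q.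
  move: #|real_part _| #|nonreal_part _| => r r'.
  move: #|real_part _| #|nonreal_part _| => s s'; lia.
Qed.
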